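(* Let $f:2^{\mathcal N}\to\mathbb R_{\ge0}$ be a non-negative (not necessarily monotone) submodular function and $\mathcal M=(\mathcal N,\mathcal I)$ a matroid. The Residual Random Greedy algorithm achieves an approximation guarantee of approximately $0.27493$ (namely $\frac{1}{\sqrt5}\big(e^{-ax^*}-e^{-bx^*}\big)$ with $a=\frac{3-\sqrt5}{2}$, $b=\frac{3+\sqrt5}{2}$, $x^*=\frac{\ln(b/a)}{\sqrt5}$) for the problem $\max\{f(S): S\in\mathcal I\}$, i.e., the expected value of its output is at least this constant times $\max\{f(S):S\in\mathcal I\}$.
   Context: A set function $f$ is submodular if $f(A\cup B)+f(A\cap B)\le f(A)+f(B)$ for all $A,B\subseteq\mathcal N$. For an independent set $S$, the contracted matroid $\mathcal M/S$ has ground set $\mathcal N\setminus S$, and $S'\subseteq\mathcal N\setminus S$ is independent in it iff $S'\cup S\in\mathcal I$. The Residual Random Greedy (RRG) algorithm (Buchbinder–Feldman–Naor–Schwartz): let $k$ be the rank of $\mathcal M$, where the ground set is padded with dummy elements contributing zero to $f$ so that bases exist of the relevant sizes (a copy $u'$ of each $u\in\mathcal N$, with $u,u'$ not both allowed, a set independent iff its projection to $\mathcal N$ is independent, and $f(S)$ depending only on $S\cap\mathcal N$). Start with $S_0=\emptyset$; for $i=1,\dots,k$, let $M_i$ be a base of $\mathcal M/S_{i-1}$ maximizing $\sum_{u\in M_i}[f(S_{i-1}\cup\{u\})-f(S_{i-1})]$, pick $u_i$ uniformly at random from $M_i$ and set $S_i=S_{i-1}\cup\{u_i\}$; output $S_k$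 restricted to the original elements. *)

(* Defs.v *)
From mathcomp Require Import all_boot all_order all_algebra.
From mathcomp Require Import reals sequences exp.

Set Implicit Arguments.
Unset Strict Implicit.
Unset Printing Implicit Defensive.

Import Order.TTheory GRing.Theory Num.Theory.
Local Open Scope ring_scope.

Section RRG.
Variable T : finType.

Definition is_matroid (I : {set {set T}}) : Prop :=
  [/\ set0 \in I,
      (forall A B : {set T}, B \in I -> A \subset B -> A \in I) &
      (forall A B : {set T}, A \in I -> B \in I -> (#|A| < #|B|)%N ->
         exists2 x, x \in B :\: A & x |: A \in I)].

Definition submodular (R : numDomainType) (f : {set T} -> R) : Prop :=
  forall A B : {set T}, f (A :|: B) + f (A :&: B) <= f A + f B.

Definition mrank (I : {set {set T}}) : nat := \max_(S in I) #|S|.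

(* Padded ground set: inl u is the original element u, inr u its dummy copy u'. *)
Definition pad_orig (S : {set T + T}) : {set T} := [set u | inl u \in S].
Definition pad_proj (S : {set T + T}) : {set T} :=
  [set u | (inl u \in S) || (inr u \in S)].

Definition pad_indep (I : {set {set T}}) (S : {set T + T}) : bool :=
  [forall u, ~~ ((inl u \in S) && (inr u \in S))] && (pad_proj S \in I).

Definition pad_f (R : Type) (f : {set T} -> R) (S : {set T + T}) : R :=
  f (pad_orig S).

(* B is a base of the contracted (padded) matroid M/S: B is independent in M/S
   (B ⊆ ground \ S and B ∪ S independent) and maximal such. *)
Definition contr_base (I : {set {set T}}) (S B : {set T + T}) : bool :=
  [&& [disjoint B & S], pad_indep I (B :|: S) &
      [forall x, (x \notin B :|: S) ==> ~~ pad_indep I (x |: (B :|: S))]].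

Definition marg_weight (R : numDomainType) (f : {set T} -> R) (S B : {set T + T}) : R :=
  \sum_(u in B) (pad_f f (u |: S) - pad_f f S).

(* A (deterministic) rule selecting M_i from the current set S_{i-1}:
   it must return a base of M/S maximizing the marginal weight. *)
Definition valid_rule (I : {set {set T}}) (R : numDomainType) (f : {set T} -> R)
  (rule : {set T + T} -> {set T + T}) : Prop :=
  forall S, pad_indep I S ->
    contr_base I S (rule S) /\
    (forall B, contr_base I S B -> marg_weight f S B <= marg_weight f S (rule S)).

(* Expected value of f on the output of RRG when n iterations remain from the
   current set S: u is drawn uniformly from M = rule S. *)
Fixpoint rrg_value (R : numFieldType) (f : {set T} -> R)
  (rule : {set T + T} -> {set T + T}) (n : nat) (S : {set T + T}) : R :=
  match n with
  | O => f (pad_orig S)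
  | n'.+1 => (#|rule S|%:R)^-1 * \sum_(u in rule S) rrg_value f rule n' (u |: S)
  end.

End RRG.

Definition rrg_const (R : realType) : R :=
  let s := Num.sqrt (5 : R) in
  let a := (3 - s) / 2 in
  let b := (3 + s) / 2 in
  let x := ln (b / a) / s in
  (expR (- (a * x)) - expR (- (b * x))) / s.

(* Main.v *)
Require Import Defs.
From mathcomp Require Import all_boot all_order all_algebra.
From mathcomp Require Import reals sequences exp.
From mathcomp Require Import zify ring lra.
Import Order.TTheory GRing.Theory Num.Theory.
Local Open Scope ring_scope.

Set Implicit Arguments.
Unset Strict Implicit.

(* Track two quantities when [n] steps remain: [f] of the current solution, and [f]
   of the current solution joined with what is left of the optimum.  An exchange
   bijection between the chosen base and the rest of the optimum shows that, in
   expectation, a step changes the pair (z, y) at least as the linear recurrence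
   z' = (1 - 2/n) z + y/n, y' = y + (z - y)/n, whose matrix has the eigenvalues
   1 - a/n and 1 - b/n.  The bound obtained is linear in the values at the stopping
   time, and the value never decreases in expectation, so one may stop at any step
   and even at a convex mixture of two consecutive steps.  Choose the mixture for
   which the product P of the factors 1 - a/n equals exp(-a x), where
   x = ln(b/a) / sqrt 5; by Bernoulli's inequality the product of the factors
   1 - b/n is at most P^(b/a) = exp(-b x).

   An element of the chosen base that also lies in the remaining optimum needs care,
   since [f] is not monotone: if there are at least two such elements, selecting one
   of them is charged with the removal of another one; if there is only one, its
   marginal value is nonnegative because it could be replaced by its dummy copy. *)

(** * Base exchange in matroids *)

Lemma indep_extend (T : finType) (I : {set {set T}}) (A B : {set T}) :
  is_matroid I -> A \in I -> B \in I -> (#|A| <= #|B|)%N ->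
  exists C : {set T}, [/\ A \subset C, C \subset A :|: B, #|C| = #|B| & C \in I].
Proof.
move=> [_ _ aug] + BI; move: {2}(#|B| - #|A|)%N (leqnn (#|B| - #|A|)) => n.
elim: n A => [|n IHn] A le_n AI leAB.
  by exists A; split=> //; [exact: subsetUl | apply/eqP; lia].
have [ltAB|geAB] := ltnP #|A| #|B|; last first.
  by exists A; split=> //; [exact: subsetUl | apply/eqP; lia].
have [x /setDP[xB xA] xAI] := aug A B AI BI ltAB.
have cx : #|x |: A| = #|A|.+1 by rewrite cardsU1 xA.
have [||C [sC Cs cC CI]] := IHn (x |: A) _ xAI; rewrite ?cx; try lia.
exists C; split=> //; first exact: subset_trans (subsetUr _ _) sC.
apply: (subset_trans Cs); rewrite -setUA subUset sub1set inE xB orbT /=.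
exact: subxx.
Qed.

Lemma mrank_ge (T : finType) (I : {set {set T}}) (A : {set T}) :
  A \in I -> (#|A| <= mrank I)%N.
Proof. by move=> AI; rewrite /mrank (bigD1 A) //= leq_maxl. Qed.

Lemma mrank_base (T : finType) (I : {set {set T}}) :
  is_matroid I -> exists2 B : {set T}, B \in I & #|B| = mrank I.
Proof.
move=> [I0 _ _]; have I_gt0 : (0 < #|I|)%N by apply/card_gt0P; exists set0.
by have [B BI cB] := eq_bigmax_cond (fun A : {set T} => #|A|) I_gt0;
  exists B; rewrite // -cB.
Qed.

Lemma indep_extend_base (T : finType) (I : {set {set T}}) (A : {set T}) :
  is_matroid I -> A \in I ->
  exists B : {set T}, [/\ A \subset B, #|B| = mrank I & B \in I].
Proof.
move=> matI AI; have [B0 B0I cB0] := mrank_base matI.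
have [|B [sAB _ cB BI]] := indep_extend matI AI B0I; first by rewrite cB0 mrank_ge.
by exists B; rewrite cB.
Qed.

Lemma card_exchange (T : finType) (X : {set T}) (x y : T) :
  x \in X -> y \notin X -> #|y |: (X :\ x)| = #|X|.
Proof. by move=> xX yX; rewrite cardsU1 !inE (negPf yX) andbF (cardsD1 x X) xX. Qed.

(** [C] collects the elements of [Y] that [x] can replace. If none of them could enter [X :\ x], the
    set [X :\ x] would span [C], hence also [x], against the independence of [X]; the proof phrases
    this with cardinalities and augmentation only. *)
Lemma symmetric_exchange (T : finType) (I : {set {set T}}) (X Y : {set T}) (x : T) :
  is_matroid I -> X \in I -> Y \in I -> #|X| = mrank I -> #|Y| = mrank I ->
  x \in X :\: Y ->
  exists y, [/\ y \in Y :\: X, y |: (X :\ x) \in I & x |: (Y :\ y) \in I].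
Proof.
move=> matI XI YI cX cY /setDP[xX xY]; have [_ sub aug] := matI.
pose C := [set y in Y | x |: (Y :\ y) \in I].
have sCY : C \subset Y by apply/subsetP=> y; rewrite inE => /andP[].
have xC : x \notin C by apply: contra xY => /(subsetP sCY).
have X'I : X :\ x \in I by apply: sub XI _; exact: subsetDl.
have cX' : #|X| = #|X :\ x|.+1 by rewrite (cardsD1 x) xX.
(* [x |: C] is the circuit that [x] closes in [Y]. *)
have xCI : x |: C \notin I.
  apply/negP=> xCI.
  (* A set [A] of size [#|Y|] inside [x |: Y] that contains [x] omits exactly one [o] of [Y], so [x]
     can replace [o]. Then [o] lies in [C], although [A] contains [C]. *)
  have [|A [sA As cA AI]] := indep_extend matI xCI YI; first by rewrite cY mrank_ge.
  have cxY : #|x |: Y| = #|Y|.+1 by rewrite cardsU1 xY.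
  have sAxY : A \subset x |: Y.
    by apply: (subset_trans As); rewrite -setUA setUS // subUset sCY subxx.
  have /subsetPn[o oxY oA] : ~~ (x |: Y \subset A).
    by apply/negP=> /subset_leq_card; rewrite cxY cA ltnn.
  have xA : x \in A by apply: (subsetP sA); rewrite !inE eqxx.
  have ox : o != x by apply: contraNneq oA => ->.
  have oY : o \in Y by move: oxY; rewrite !inE (negPf ox).
  have oC : o \in C.
    rewrite inE oY; apply: sub AI _.
    suff -> : A = x |: (Y :\ o) by [].
    apply/eqP; rewrite eqEcard card_exchange // cA leqnn andbT.
    apply/subsetP=> z zA; have := subsetP sAxY z zA; rewrite !inE.
    case: (z =P x) => //= _ zY; rewrite zY andbT.
    by apply: contraNneq oA => <-.
  by case/negP: oA; apply: (subsetP sA); rewrite inE oC orbT.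
have [/existsP[y /and3P[yYX H1 H2]]|nex] := boolP [exists y,
  [&& y \in Y :\: X, y |: (X :\ x) \in I & x |: (Y :\ y) \in I]].
  by exists y.
exfalso; case/negP: xCI.
have CX y : y \in C -> y \notin X :\ x -> y |: (X :\ x) \notin I.
  move=> yC yX; apply: contra nex => H; apply/existsP; exists y.
  move: yC; rewrite inE => /andP[yY ->]; rewrite H !inE yY /= !andbT.
  have yx : y != x by apply: contraNneq xY => <-.
  by move: yX; rewrite !inE yx.
have CI : C \in I := sub _ _ YI sCY.
have cC : (#|C| <= #|X :\ x|)%N.
  rewrite leqNgt; apply/negP=> /(aug _ _ X'I CI)[y /setDP[yC yX]].
  exact/negP/CX.
(* Augmenting [W] from [X] either adds [x], which makes [x |: C] independent, or gives a full-size
   set [z |: W]. In the latter case augmenting [X :\ x] from it must use an element of [C]. *)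
have [W [sCW sW cW WI]] := indep_extend matI CI X'I cC.
have [|z /setDP[zX zW] zWI] := aug W X WI XI; first by rewrite cX' cW.
have [zx|zx] := eqVneq z x.
  by apply: sub zWI _; rewrite -zx setUS.
have [|y /setDP[yzW yX]] := aug _ _ X'I zWI; first by rewrite cardsU1 zW cW.
have zX' : z \in X :\ x by rewrite !inE zx.
have yC : y \in C.
  move: yzW; rewrite in_setU1 => /orP[/eqP yz|/(subsetP sW)].
    by rewrite yz zX' in yX.
  by rewrite in_setU (negPf yX) orbF.
by move=> H; case/negP: (CX y yC yX).
Qed.

(** Induction on [#|X :\: Y|]. One half of the symmetric exchange makes [y |: (X :\ x)] a base
    closer to [Y], whose bijection fixes [y]; the other half permits sending [x] to [y] instead. *)
Lemma base_exchange_bijection (T : finType) (I : {set {set T}}) (X Y : {set T}) :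
  is_matroid I -> X \in I -> Y \in I -> #|X| = mrank I -> #|Y| = mrank I ->
  exists g : T -> T, [/\ {in X &, injective g}, g @: X = Y,
    (forall x, x \in X -> x \in Y -> g x = x) &
    (forall x, x \in X -> x |: (Y :\ g x) \in I)].
Proof.
move=> matI + YI + cY; move: {2}#|X :\: Y| (leqnn #|X :\: Y|) => n.
elim: n X => [|n IHn] X le_n XI cX.
  have XY : X = Y.
    apply/eqP; rewrite eqEcard cX cY leqnn andbT -setD_eq0 -cards_eq0.
    by rewrite -leqn0.
  exists id; split=> //; first by rewrite imset_id.
  by move=> x xX; rewrite -XY setD1K.
have [XY0|[x xXY]] := set_0Vmem (X :\: Y).
  by apply: IHn => //; rewrite XY0 cards0.
have [y [yYX H1 H2]] := symmetric_exchange matI XI YI cX cY xXY.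
move: (xXY) (yYX) => /setDP[xX xY] /setDP[yY yX].
have [||g [ginj gim gid gI]] := IHn (y |: (X :\ x)) _ H1.
- rewrite -ltnS; apply: leq_trans le_n; apply: proper_card; apply/properP; split.
    apply/subsetP=> z; rewrite !inE; case: (z =P y) => [->|_]; first by rewrite yY.
    by move=> /andP[->] /andP[_ ->].
  by exists x; rewrite // !inE (negPf xY) eqxx /= orbF; apply: contraNneq yX => <-.
- by rewrite card_exchange.
have gy : g y = y by apply: gid => //; rewrite !inE eqxx.
have X'P z : z \in X -> z != x -> z \in y |: (X :\ x).
  by move=> zX zx; rewrite !inE zx zX orbT.
have gyX z : z \in X -> z != x -> g z != y.
  move=> zX zx; apply: contraNneq yX => gzy.
  have -> // : y = z.
  by apply: ginj; [rewrite !inE eqxx | exact: X'P | rewrite gy gzy].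
pose h z := if z == x then y else g z.
have hinj : {in X &, injective h}.
  move=> z w zX wX; rewrite /h; case: eqVneq => [->|zx]; case: eqVneq => [->|wx] //.
  - by move=> E; have := gyX w wX wx; rewrite -E eqxx.
  - by move=> E; have := gyX z zX zx; rewrite E eqxx.
  - by apply: ginj; apply: X'P.
exists h; split=> //.
- apply/eqP; rewrite eqEcard card_in_imset // cX cY leqnn andbT.
  apply/subsetP=> _ /imsetP[z zX ->]; rewrite /h; case: eqVneq => [//|zx].
  by rewrite -gim imset_f ?X'P.
- move=> z zX zY; rewrite /h; case: eqVneq => [zx|zx]; first by rewrite -zx zY in xY.
  by apply: gid => //; apply: X'P.
- by move=> z zX; rewrite /h; case: eqVneq => [->|zx] //; apply/gI/X'P.
Qed.

(** * Submodular functions *)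

Lemma submodular_addition_sum (T : finType) (R : realFieldType) (f : {set T} -> R)
    (A X : {set T}) :
  submodular f -> f (A :|: X) - f A <= \sum_(x in X) (f (x |: A) - f A).
Proof.
move=> subf; move: {2}#|X| (erefl #|X|) => n; elim: n X => [|n IHn] X cX.
  by rewrite (cards0_eq cX) setU0 subrr big_set0.
have [x xX] : exists x, x \in X by apply/card_gt0P; rewrite cX.
have cX' : #|X :\ x| = n by move: cX; rewrite (cardsD1 x) xX => -[].
rewrite (big_setD1 x xX) /=.
have := IHn _ cX'; have := subf (A :|: X :\ x) (x |: A).
have -> : A :|: X :\ x :|: (x |: A) = A :|: X.
  apply/setP=> z; rewrite !inE; case: (z =P x) => [->|_]; rewrite ?xX ?orbT //=.
  by case: (z \in A); rewrite ?orbT ?orbF.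
have -> : (A :|: X :\ x) :&: (x |: A) = A.
  by apply/setP=> z; rewrite !inE; case: (z =P x) => [->|_] /=;
    case: (_ \in A); rewrite ?andbF ?andbT.
lra.
Qed.

Lemma submodular_removal_sum (T : finType) (R : realFieldType) (f : {set T} -> R)
    (A X : {set T}) :
  submodular f -> f (A :\: X) - f A <= \sum_(x in X) (f (A :\ x) - f A).
Proof.
move=> subf; move: {2}#|X| (erefl #|X|) => n; elim: n X => [|n IHn] X cX.
  by rewrite (cards0_eq cX) setD0 subrr big_set0.
have [x xX] : exists x, x \in X by apply/card_gt0P; rewrite cX.
have cX' : #|X :\ x| = n by move: cX; rewrite (cardsD1 x) xX => -[].
rewrite (big_setD1 x xX) /=.
have := IHn _ cX'; have := subf (A :\: (X :\ x)) (A :\ x).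
have -> : A :\: (X :\ x) :|: A :\ x = A.
  by apply/setP=> z; rewrite !inE; case: (z =P x) => [->|_] /=;
    case: (_ \in A); rewrite ?andbF ?andbT ?orbT.
have -> : (A :\: (X :\ x)) :&: (A :\ x) = A :\: X.
  apply/setP=> z; rewrite !inE; case: (z =P x) => [->|_] /=; rewrite ?xX ?andbF //.
  by case: (z \in A); rewrite ?andbF ?andbT.
lra.
Qed.

(** Summing the hypothesis over ordered pairs of distinct elements counts each element [#|P|.-1]
    times on either side. A singleton has no such pair. *)
Lemma sum_ge_offdiagonal (T : finType) (R : realFieldType) (P : {set T})
    (h W : T -> R) :
  #|P| != 1%N -> (forall x y, x \in P -> y \in P -> x != y -> h y <= W x) ->
  \sum_(x in P) h x <= \sum_(x in P) W x.
Proof.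
move=> cP1 hW; have [c0|c_gt0] := posnP #|P|.
  by rewrite (cards0_eq c0) !big_set0.
have cE x : x \in P -> #|P :\ x| = #|P|.-1 by move=> xP; rewrite (cardsD1 x P) xP.
have c_pos : 0 < #|P|.-1%:R :> R by rewrite ltr0n; lia.
rewrite -(ler_pM2l c_pos) !mulr_sumr.
have -> : \sum_(x in P) #|P|.-1%:R * h x = \sum_(x in P) \sum_(y in P :\ x) h y.
  rewrite (exchange_big_dep (mem P)) /=; last by move=> x y _ /setD1P[].
  apply: eq_bigr => y yP; rewrite -(cE y yP) mulr_natl -sumr_const.
  by apply: eq_bigl => x; rewrite !inE yP andbT eq_sym andbC.
apply: ler_sum => x xP; rewrite -(cE x xP) mulr_natl -sumr_const.
by apply: ler_sum => y /setD1P[yx yP]; apply: hW; rewrite // eq_sym.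
Qed.

(** Each choice of [x] inserts [x] into [A] and removes [g x] from it. By submodularity all removals
    together cost at most [f A - f S], and all insertions at most [f A] because [f] is nonnegative;
    this accounts for the [- 2] and the extra [f S]. In the application [B] is the projection of the
    chosen base, [N] its non-dummy part, and [W x] a value reached after choosing [x]. *)
Lemma exchange_sum_lower_bound (T : finType) (R : realFieldType)
    (f : {set T} -> R) (S O B N : {set T}) (g : T -> T) (W : T -> R) :
  let A := O :|: S in
  submodular f -> (forall X, 0 <= f X) -> [disjoint O & S] ->
  N \subset B -> [disjoint B & S] ->
  {in B &, injective g} -> O \subset g @: B -> [disjoint g @: B & S] ->
  (forall x, x \in B -> x \in O -> g x = x) ->
  (forall x, x \in N :&: O -> f S <= f (x |: S)) ->
  (forall x, x \in N :\: O -> f (x |: (A :\ g x)) <= W x) ->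
  (forall x, x \in B :\: N -> f (A :\ g x) <= W x) ->
  (forall x, x \in N :&: O -> f A <= W x) ->
  (forall x y, x \in N :&: O -> y \in N :&: O -> x != y -> f (A :\ y) <= W x) ->
  (#|B|%:R - 2) * f A + f S <= \sum_(x in B) W x.
Proof.
move=> A subf f0 dOS sNB dBS ginj sOB dgS gid fP WNO WBN WP WPP.
pose d y := f (A :\ y) - f A; set P := N :&: O in fP WP WPP.
have sPB : P \subset B by apply: subset_trans sNB; exact: subsetIl.
have sPO : P \subset O by exact: subsetIr.
(* Only when [P] is a singleton is its element kept, at no gain over [f A]. *)
have [Q [sQP fQ WQ]] : exists Q : {set T}, [/\ Q \subset P, f S <= f (Q :|: S) &
    #|P|%:R * f A + \sum_(x in P :\: Q) d x <= \sum_(x in P) W x].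
  have [/cards1P[p Pp]|cP] := boolP (#|P| == 1%N).
    exists P; split=> //; first by rewrite Pp fP // Pp inE.
    rewrite setDv big_set0 addr0 mulr_natl -sumr_const; exact: ler_sum.
  exists set0; split; rewrite ?sub0set ?set0U //.
  rewrite setD0 mulr_natl -sumr_const -big_split /=.
  under eq_bigr do rewrite addrC subrK.
  exact: sum_ge_offdiagonal.
have eB : \sum_(x in N :\: O) (f (x |: A) - f A) >= - f A.
  apply: le_trans (submodular_addition_sum A (N :\: O) subf).
  by have := f0 (A :|: N :\: O); lra.
have WD : #|B :\: P|%:R * f A + \sum_(x in B :\: P) d (g x)
    + \sum_(x in N :\: O) (f (x |: A) - f A) <= \sum_(x in B :\: P) W x.
  have -> : \sum_(x in N :\: O) (f (x |: A) - f A) =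
      \sum_(x in B :\: P) (if x \in N then f (x |: A) - f A else 0).
    rewrite -big_mkcondr; apply: eq_bigl => x; rewrite !inE.
    by case xN: (x \in N); rewrite ?andbF ?andbT //= (subsetP sNB x xN) andbT.
  rewrite mulr_natl -sumr_const -!big_split /=; apply: ler_sum => x xBP.
  move: (xBP); rewrite !inE => /andP[xP xB]; case: ifP xP => [xN /= xO|xN _].
    have := WNO x; rewrite !inE xN xO => /(_ isT).
    have xA : x \notin A by rewrite !inE (negPf xO) (disjointFr dBS xB).
    (* This instance separates the exchange into an insertion into [A] and a removal from [A]. *)
    have := subf (x |: (A :\ g x)) A.
    have -> : x |: (A :\ g x) :|: A = x |: A.
      by rewrite -setUA; congr (_ :|: _); apply/setUidPr; exact: subsetDl.
    have -> : (x |: (A :\ g x)) :&: A = A :\ g x.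
      apply/setP=> z; rewrite !inE -/A; case: (z =P x) => [->|_] /=.
        by move: xA; rewrite !inE => /negPf ->; rewrite andbF.
      by case: (z \in O); case: (z \in S); rewrite ?andbT ?andbF.
    rewrite /d; lra.
  by have := WBN x; rewrite !inE xN xB => /(_ isT); rewrite /d; lra.
(* Reindexing along [g]: an image outside [O] lies outside [A], so its removal changes nothing, and
   [g] fixes [P], so the images inside [O] are exactly [O :\: P]. *)
have dgE : \sum_(x in B :\: P) d (g x) = \sum_(y in O :\: P) d y.
  rewrite -(big_imset (h := g)) /=; last first.
    by move=> x y /setDP[xB _] /setDP[yB _]; apply: ginj.
  rewrite (big_setID O) /= [X in _ + X]big1 ?addr0 => [|y /setDP[]]; last first.
    case/imsetP=> x /setDP[xB _] -> gxO; rewrite /d.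
    suff -> : A :\ g x = A by rewrite subrr.
    apply/setP=> z; rewrite !inE; case: (z =P g x) => [->|//].
    by rewrite (negPf gxO) (disjointFr dgS) // imset_f.
  apply: eq_bigl => y; rewrite in_setI in_setD; apply/andP/idP.
    case=> /imsetP[x /setDP[xB xP] ->] gO; rewrite gO andbT.
    apply: contra xP => gP; suff -> : x = g x by [].
    apply: ginj => //; first exact: (subsetP sPB).
    by rewrite [RHS]gid // (subsetP sPB).
  move=> /andP[yP yO]; split=> //.
  have /imsetP[x xB yE] := subsetP sOB y yO.
  rewrite yE imset_f // in_setD xB andbT; apply: contra yP => xP.
  by rewrite yE gid // (subsetP sPO).
have cB : #|B|%:R = #|P|%:R + #|B :\: P|%:R :> R.
  by rewrite -natrD -(cardsID P B) (setIidPr sPB).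
have dO : f S - f A <= \sum_(y in O :\: Q) d y.
  apply: le_trans (submodular_removal_sum A (O :\: Q) subf); rewrite lerD2r.
  suff -> : A :\: (O :\: Q) = Q :|: S by [].
  apply/setP=> z; rewrite !inE; case zQ: (z \in Q) => /=.
    by rewrite (subsetP sPO z (subsetP sQP z zQ)).
  by case zO: (z \in O) => //=; rewrite (disjointFr dOS zO).
clearbody P.
have dOQ : \sum_(y in O :\: Q) d y = \sum_(x in P :\: Q) d x + \sum_(y in O :\: P) d y.
  rewrite (big_setID P) /=; congr (_ + _); apply: eq_bigl => z; rewrite !inE.
    by case zP: (z \in P); rewrite ?andbF // (subsetP sPO z zP) !andbT.
  by case zQ: (z \in Q); rewrite ?(subsetP sQP z zQ) ?andbF.
rewrite (big_setID P) /= (setIidPr sPB) cB; move: WQ WD; rewrite dgE.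
move: dO; rewrite dOQ; lra.
Qed.

(** * The padded matroid *)

Definition pad_collapse (T : Type) (u : T + T) : T :=
  match u with inl x | inr x => x end.

Lemma pad_proj_imset (T : finType) (X : {set T + T}) :
  pad_proj X = @pad_collapse T @: X.
Proof.
apply/setP=> x; rewrite inE; apply/orP/imsetP.
  by case=> xX; [exists (inl x) | exists (inr x)].
by case=> -[y|y] yX ->; [left | right].
Qed.

Lemma pad_projU (T : finType) (X Y : {set T + T}) :
  pad_proj (X :|: Y) = pad_proj X :|: pad_proj Y.
Proof. by rewrite !pad_proj_imset imsetU. Qed.

Lemma pad_projU1 (T : finType) (u : T + T) (X : {set T + T}) :
  pad_proj (u |: X) = pad_collapse u |: pad_proj X.
Proof. by rewrite !pad_proj_imset imsetU1. Qed.

Lemma pad_origU1l (T : finType) (x : T) (X : {set T + T}) :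
  pad_orig (inl x |: X) = x |: pad_orig X.
Proof. by apply/setP=> y; rewrite !inE. Qed.

Lemma pad_origU1r (T : finType) (x : T) (X : {set T + T}) :
  pad_orig (inr x |: X) = pad_orig X.
Proof. by apply/setP=> y; rewrite !inE. Qed.

Lemma pad_orig_sub_proj (T : finType) (X : {set T + T}) : pad_orig X \subset pad_proj X.
Proof. by apply/subsetP=> x; rewrite !inE => ->. Qed.

Lemma pad_indep_inj (T : finType) (I : {set {set T}}) (X : {set T + T}) :
  pad_indep I X -> {in X &, injective (@pad_collapse T)}.
Proof.
move=> /andP[/forallP noboth _] [x|x] [y|y] xX yX /= E; rewrite E // in xX *;
  by have := noboth y; rewrite xX yX.
Qed.

Lemma card_pad_proj (T : finType) (I : {set {set T}}) (X : {set T + T}) :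
  pad_indep I X -> #|pad_proj X| = #|X|.
Proof.
move=> indX; rewrite pad_proj_imset card_in_imset //; exact: pad_indep_inj indX.
Qed.

Lemma pad_indepU1 (T : finType) (I : {set {set T}}) (u : T + T) (X : {set T + T}) :
  pad_indep I X -> pad_collapse u \notin pad_proj X ->
  pad_collapse u |: pad_proj X \in I -> pad_indep I (u |: X).
Proof.
move=> /andP[/forallP noboth _] uX uXI; rewrite /pad_indep pad_projU1 uXI andbT.
apply/forallP=> y; have := noboth y; rewrite !in_setU1.
case: u uX {uXI} => x /=; rewrite inE => /norP[xl xr].
  rewrite (inj_eq (@inl_inj T T)) /=.
  by case: (y =P x) => [->|]; rewrite ?(negPf xr).
rewrite (inj_eq (@inr_inj T T)) /=.
by case: (y =P x) => [->|]; rewrite ?(negPf xl).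
Qed.

Lemma pad_indep_sub (T : finType) (I : {set {set T}}) (X Y : {set T + T}) :
  is_matroid I -> pad_indep I Y -> X \subset Y -> pad_indep I X.
Proof.
move=> [_ sub _] /andP[/forallP noboth YI] sXY; apply/andP; split.
  apply/forallP=> x; apply: contra (noboth x) => /andP[xl xr].
  by rewrite !(subsetP sXY).
by apply: sub YI _; rewrite !pad_proj_imset imsetS.
Qed.

(** Were the projection short of full rank, augmentation would supply an element whose original copy
    extends [M :|: S], against maximality. *)
Lemma card_contr_base_proj (T : finType) (I : {set {set T}}) (S M : {set T + T}) :
  is_matroid I -> contr_base I S M -> #|pad_proj (M :|: S)| = mrank I.
Proof.
move=> matI /and3P[_ indMS /forallP maxM].
have pI : pad_proj (M :|: S) \in I by case/andP: indMS.
apply/eqP; rewrite eqn_leq mrank_ge //= leqNgt; apply/negP=> lt_mrank.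
have [B BI cB] := mrank_base matI; have [_ _ aug] := matI.
have [|x /setDP[_ xMS] xI] := aug _ _ pI BI; first by rewrite cB.
have := maxM (inl x); rewrite pad_indepU1 // implybF => /negP; apply.
by apply: contra xMS => xMS; rewrite inE xMS.
Qed.

Lemma contr_base_disjoint_proj (T : finType) (I : {set {set T}}) (S M : {set T + T}) :
  contr_base I S M -> [disjoint pad_proj M & pad_proj S].
Proof.
move=> /and3P[dMS indMS _]; have inj := pad_indep_inj indMS.
rewrite disjoint_subset !pad_proj_imset; apply/subsetP=> _ /imsetP[u uM ->].
rewrite inE; apply/imsetP=> -[v vS uv].
have uv' : u = v by apply: inj; rewrite // inE ?uM ?vS ?orbT.
by rewrite -uv' (disjointFr dMS uM) in vS.
Qed.

Lemma card_contr_base (T : finType) (I : {set {set T}}) (S M : {set T + T}) :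
  is_matroid I -> contr_base I S M -> (#|S| + #|M|)%N = mrank I.
Proof.
move=> matI bM; rewrite -(card_contr_base_proj matI bM).
case/and3P: bM => dMS indMS _.
by rewrite (card_pad_proj indMS) cardsU (disjoint_setI0 dMS) cards0 subn0 addnC.
Qed.

(** An independent set holds at most one copy of each element, so sums over padded elements become
    sums over [T], where the exchange bijection lives. *)
Lemma big_sum_pad_proj (T : finType) (R : realFieldType) (I : {set {set T}})
    (M : {set T + T}) (h : T + T -> R) :
  pad_indep I M ->
  \sum_(x in pad_proj M) (if inl x \in M then h (inl x) else h (inr x)) =
  \sum_(u in M) h u.
Proof.
move=> indM; rewrite pad_proj_imset big_imset /=; last exact: pad_indep_inj indM.
case/andP: indM => /forallP noboth _; apply: eq_bigr => -[x|x] xM /=.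
  by rewrite xM.
by case: ifP => // xM'; have := noboth x; rewrite xM xM'.
Qed.

Lemma marg_weight_orig (T : finType) (R : realFieldType) (f : {set T} -> R)
    (S M : {set T + T}) :
  marg_weight f S M = \sum_(x in pad_orig M) (f (x |: pad_orig S) - f (pad_orig S)).
Proof.
rewrite /marg_weight big_sumType /= [X in _ + X]big1 ?addr0 => [|x _].
  by apply: eq_big => [x|x _]; rewrite ?inE // /pad_f pad_origU1l.
by rewrite /pad_f pad_origU1r subrr.
Qed.

(** This is the purpose of the dummies: complete [X :|: pad_proj S] to a base of the original
    matroid and take the missing elements as dummies. Any such [X] thus competes with the chosen
    base, whatever its size. *)
Lemma contr_base_lift (T : finType) (I : {set {set T}}) (S : {set T + T}) (X : {set T}) :
  is_matroid I -> pad_indep I S -> [disjoint X & pad_proj S] ->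
  X :|: pad_proj S \in I -> exists2 M, contr_base I S M & pad_orig M = X.
Proof.
move=> matI indS dXS XI; have [Y [sXY cY YI]] := indep_extend_base matI XI.
pose D := Y :\: (X :|: pad_proj S); pose M := inl @: X :|: inr @: D : {set T + T}.
have Ml x : (inl x \in M) = (x \in X).
  rewrite inE (mem_imset _ _ (@inl_inj T T)); apply/orb_idr.
  by case/imsetP.
have Mr x : (inr x \in M) = (x \in D).
  rewrite inE (mem_imset _ _ (@inr_inj T T)); apply/orb_idl.
  by case/imsetP.
clearbody M; exists M; last by apply/setP=> x; rewrite inE Ml.
have pM : pad_proj (M :|: S) = Y.
  apply/setP=> x; rewrite pad_projU inE [x \in pad_proj M]inE Ml Mr in_setD.
  have := subsetP sXY x; rewrite in_setU.
  by case: (x \in X); case: (x \in pad_proj S) => /= H;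
    rewrite ?orbF // H.
have indM : pad_indep I (M :|: S).
  rewrite /pad_indep pM YI andbT; apply/forallP=> x.
  case/andP: indS => /forallP /(_ x) + _.
  rewrite !in_setU Ml Mr in_setD in_setU.
  have := disjointFr dXS (x := x); rewrite [_ \in pad_proj S]inE.
  case: (x \in X) => [/(_ isT)/norP[/negPf -> /negPf ->]|_] //=.
  by case: (inl x \in S); case: (inr x \in S).
have dMS : [disjoint M & S].
  rewrite disjoint_subset; apply/subsetP=> -[x|x]; rewrite inE.
    rewrite Ml => /(disjointFr dXS); rewrite inE => /norP[xl _]; exact: xl.
  by rewrite Mr in_setD in_setU inE => /andP[/norP[_ /norP[]]].
apply/and3P; split=> //; apply/forallP=> u; apply/implyP=> uM; apply/negP=> indu.
have := mrank_ge (proj2 (andP indu)); rewrite (card_pad_proj indu).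
by rewrite cardsU1 uM -(card_pad_proj indM) pM cY ltnn.
Qed.

Lemma rule_weight_max (T : finType) (R : realFieldType) (I : {set {set T}})
    (f : {set T} -> R) (rule : {set T + T} -> {set T + T}) (S : {set T + T})
    (X : {set T}) :
  is_matroid I -> valid_rule I f rule -> pad_indep I S ->
  [disjoint X & pad_proj S] -> X :|: pad_proj S \in I ->
  \sum_(x in X) (f (x |: pad_orig S) - f (pad_orig S)) <= marg_weight f S (rule S).
Proof.
move=> matI vr indS dXS XI; have [M bM <-] := contr_base_lift matI indS dXS XI.
by rewrite -marg_weight_orig; apply: (proj2 (vr S indS)).
Qed.

(** * One step of the algorithm *)

(* [O] is what remains of the optimum: it can still be added to the current
   solution [S], and it avoids every element consumed so far, dummy or not. *)
Definition rrg_guarantee (T : finType) (R : realFieldType) (I : {set {set T}})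
    (f : {set T} -> R) (rule : {set T + T} -> {set T + T}) (n : nat) (al be : R) :=
  [/\ 0 <= al, 0 <= be &
    forall (S : {set T + T}) (O : {set T}),
      pad_indep I S -> (#|S| + n)%N = mrank I -> [disjoint O & pad_proj S] ->
      O :|: pad_proj S \in I ->
      al * f (O :|: pad_orig S) + be * f (pad_orig S) <= rrg_value f rule n S].

Lemma rrg_guarantee_convex (T : finType) (R : realFieldType) (I : {set {set T}})
    (f : {set T} -> R) (rule : {set T + T} -> {set T + T}) (n : nat)
    (al be al' be' t : R) :
  0 <= t <= 1 -> rrg_guarantee I f rule n al be -> rrg_guarantee I f rule n al' be' ->
  rrg_guarantee I f rule n (t * al + (1 - t) * al') (t * be + (1 - t) * be').
Proof.
move=> /andP[t0 t1] [al0 be0 H] [al0' be0' H'].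
have t1' : 0 <= 1 - t by lra.
split; try by rewrite addr_ge0 ?mulr_ge0.
move=> S O indS cS dO OI.
have := ler_wpM2l t0 (H S O indS cS dO OI).
have := ler_wpM2l t1' (H' S O indS cS dO OI).
move: (f _) (f _) (rrg_value _ _ _ _) => F G V; lra.
Qed.

Lemma rule_step_indep (T : finType) (R : realFieldType) (I : {set {set T}})
    (f : {set T} -> R) (rule : {set T + T} -> {set T + T}) (n : nat)
    (S : {set T + T}) (u : T + T) :
  is_matroid I -> valid_rule I f rule -> pad_indep I S ->
  (#|S| + n.+1)%N = mrank I -> u \in rule S ->
  [/\ pad_indep I (u |: S), (#|u |: S| + n)%N = mrank I &
      pad_collapse u \notin pad_proj S].
Proof.
move=> matI vr indS cS uM; have [bM _] := vr S indS.
have dMS := contr_base_disjoint_proj bM.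
case/and3P: bM => dMS' indMS _; split.
- by apply: pad_indep_sub indMS _ => //; rewrite setSU // sub1set.
- by rewrite cardsU1 (disjointFr dMS' uM) add1n addSnnS.
- by rewrite (disjointFr dMS) // pad_proj_imset imset_f.
Qed.

Lemma card_rule (T : finType) (R : realFieldType) (I : {set {set T}})
    (f : {set T} -> R) (rule : {set T + T} -> {set T + T}) (n : nat) (S : {set T + T}) :
  is_matroid I -> valid_rule I f rule -> pad_indep I S ->
  (#|S| + n)%N = mrank I -> #|rule S| = n.
Proof.
move=> matI vr indS cS; have [bM _] := vr S indS.
by apply/eqP; rewrite -(eqn_add2l #|S|) cS (card_contr_base matI bM).
Qed.

Lemma sum_pad_f (T : finType) (R : realFieldType) (f : {set T} -> R)
    (S M : {set T + T}) :
  \sum_(u in M) f (pad_orig (u |: S)) = #|M|%:R * f (pad_orig S) + marg_weight f S M.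
Proof.
rewrite /marg_weight mulr_natl -sumr_const -big_split /=.
by apply: eq_bigr => u _; rewrite /pad_f addrC subrK.
Qed.

(** The empty set, filled up with dummies, has weight zero, so the chosen base has nonnegative
    weight and the value does not drop in expectation. *)
Lemma rrg_guarantee_current (T : finType) (R : realFieldType) (I : {set {set T}})
    (f : {set T} -> R) (rule : {set T + T} -> {set T + T}) (n : nat) :
  is_matroid I -> valid_rule I f rule -> rrg_guarantee I f rule n 0 1.
Proof.
move=> matI vr; split=> // S O + + _ _; rewrite mul0r add0r mul1r.
elim: n S => [|n IHn] S indS cS //=; rewrite (card_rule matI vr indS cS).
rewrite ler_pdivlMl ?ltr0n //.
have : \sum_(u in rule S) f (pad_orig (u |: S)) <=
       \sum_(u in rule S) rrg_value f rule n (u |: S).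
  apply: ler_sum => u uM; have [indu cu _] := rule_step_indep matI vr indS cS uM.
  exact: IHn.
apply: le_trans; rewrite sum_pad_f (card_rule matI vr indS cS) lerDl.
apply: le_trans (rule_weight_max (X := set0) matI vr indS _ _); rewrite ?big_set0 //.
  by rewrite -setI_eq0 set0I.
by rewrite set0U; case/andP: indS.
Qed.

(** The [al] part is bounded by the exchange argument, the [be] part by the optimality of the base
    against [O]. The sign hypothesis matters when [n = 0], where [1 - 2 / n.+1%:R] is [-1]. *)
Lemma rrg_guarantee_step (T : finType) (R : realFieldType) (I : {set {set T}})
    (f : {set T} -> R) (rule : {set T + T} -> {set T + T}) (n : nat) (al be : R) :
  is_matroid I -> (forall S, 0 <= f S) -> submodular f -> valid_rule I f rule ->
  0 <= (1 - 2 / n.+1%:R) * al + be / n.+1%:R ->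
  rrg_guarantee I f rule n al be ->
  rrg_guarantee I f rule n.+1 ((1 - 2 / n.+1%:R) * al + be / n.+1%:R)
    ((1 - n.+1%:R^-1) * be + al / n.+1%:R).
Proof.
move=> matI f0 subf vr al0' [al0 be0 H]; split=> //.
  rewrite addr_ge0 ?divr_ge0 ?mulr_ge0 // subr_ge0 invf_le1 ?ltr0n //.
  by rewrite ler1n.
move=> S O indS cS dO OI; have [bM _] := vr S indS.
have cM := card_rule matI vr indS cS.
have [_ sub _] := matI.
have dMS := contr_base_disjoint_proj bM.
have cX := card_contr_base_proj matI bM.
have indMS : pad_indep I (rule S :|: S) by case/and3P: bM.
have indM : pad_indep I (rule S).
  by apply: pad_indep_sub indMS _ => //; exact: subsetUl.
set M := rule S in bM cM dMS cX indMS indM *.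
have XI : pad_proj (M :|: S) \in I by case/andP: indMS.
have [Y [sOY cY YI]] := indep_extend_base matI OI.
(* Both bases contain [pad_proj S], which [g] therefore fixes; so [g] maps the projection of [M] off
   [pad_proj S] and onto a set containing [O]. *)
have [g [ginj gim gid gI]] := base_exchange_bijection matI XI YI cX cY.
move: ginj gim gid gI; rewrite pad_projU => ginj gim gid gI.
have sSY : pad_proj S \subset Y by apply: subset_trans sOY; exact: subsetUr.
have gS x : x \in pad_proj S -> g x = x.
  by move=> xS; apply: gid; [rewrite inE xS orbT | exact: (subsetP sSY)].
have gnS x : x \in pad_proj M -> g x \notin pad_proj S.
  move=> xM; apply/negP=> gxS; suff xE : x = g x.
    by rewrite -xE (disjointFr dMS xM) in gxS.
  by apply: ginj; rewrite ?(gS _ gxS) // inE ?xM ?gxS ?orbT.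
have sOrig := pad_orig_sub_proj S.
(* The remaining optimum after [u] is chosen may be any part of [O] that avoids
   both [u] and the element exchanged for it. *)
have HO u (O' : {set T}) : u \in M -> O' \subset O -> pad_collapse u \notin O' ->
    g (pad_collapse u) \notin O' ->
    al * f (O' :|: pad_orig (u |: S)) + be * f (pad_orig (u |: S)) <=
    rrg_value f rule n (u |: S).
  move=> uM sO' uO' guO'; have [indu cu uS] := rule_step_indep matI vr indS cS uM.
  have puM : pad_collapse u \in pad_proj M by rewrite pad_proj_imset imset_f.
  apply: H => //; rewrite pad_projU1.
    rewrite disjoint_subset; apply/subsetP=> x xO'; rewrite !inE.
    have := disjointFr dO (subsetP sO' x xO'); rewrite inE => ->; rewrite orbF.
    by apply: contraNneq uO' => <-.
  apply: (sub _ _ (gI (pad_collapse u) _)); first by rewrite inE puM.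
  rewrite setUCA setUS //; apply/subsetP=> x xOS; rewrite in_setD1; apply/andP; split.
    apply: contraTneq xOS => ->; rewrite in_setU (negPf guO') /=; exact: gnS.
  apply: (subsetP sOY); apply: subsetP xOS; exact: setSU.
have fP x : x \in pad_orig M :&: O -> f (pad_orig S) <= f (x |: pad_orig S).
  move=> /setIP[xM _].
  have sMx : pad_orig M :\ x \subset pad_proj M.
    by apply: subset_trans (pad_orig_sub_proj M); exact: subsetDl.
  have := rule_weight_max (X := pad_orig M :\ x) matI vr indS.
  rewrite marg_weight_orig -/M (big_setD1 x xM) /= lerDr subr_ge0; apply.
    exact: disjointWl sMx dMS.
  by apply: sub XI _; rewrite pad_projU setSU.
(* The [be] part is subtracted because [sum_pad_f] sums it exactly; only the [al] part needs the
   exchange. *)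
pose W x := if inl x \in M
  then rrg_value f rule n (inl x |: S) - be * f (pad_orig (inl x |: S))
  else rrg_value f rule n (inr x |: S) - be * f (pad_orig (inr x |: S)).
set A := O :|: pad_orig S.
have AD y : y \notin pad_orig S -> A :\ y = O :\ y :|: pad_orig S.
  move=> yS; apply/setP=> z; rewrite !inE.
  by case: (z =P y) => [->|] //=; move: yS; rewrite inE => /negPf ->.
have gnS' x : x \in pad_proj M -> g x \notin pad_orig S.
  by move=> /gnS; apply: contra; exact: (subsetP sOrig).
have xMl x : x \in pad_orig M -> inl x \in M by rewrite inE.
have xMp x : x \in pad_orig M -> x \in pad_proj M.
  exact: (subsetP (pad_orig_sub_proj M)).
have xS x : x \in pad_proj M -> x \notin pad_orig S.
  by move=> xM; apply: contraFN (disjointFr dMS xM); exact: (subsetP sOrig).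
have gO x : x \in pad_proj M -> x \in O -> g x = x.
  move=> xM xO; apply: gid; first by rewrite inE xM.
  by apply: (subsetP sOY); rewrite inE xO.
have HW : (#|pad_proj M|%:R - 2) * (al * f A) + al * f (pad_orig S) <=
    \sum_(x in pad_proj M) W x.
  apply: (@exchange_sum_lower_bound T R (fun X => al * f X) (pad_orig S) O
    (pad_proj M) (pad_orig M) g W).
  - by move=> X Z; rewrite -!mulrDr ler_wpM2l.
  - by move=> X; rewrite mulr_ge0.
  - exact: disjointWr sOrig dO.
  - exact: pad_orig_sub_proj.
  - exact: disjointWr sOrig dMS.
  - by move=> x y xM yM; apply: ginj; rewrite inE ?xM ?yM.
  - apply/subsetP=> o oO; have : o \in Y by apply: (subsetP sOY); rewrite inE oO.
    rewrite -gim => /imsetP[x + oE]; rewrite oE inE => /orP[xM|xS']; first exact: imset_f.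
    by move: oO; rewrite oE gS // => /(disjointFr dO); rewrite xS'.
  - rewrite disjoint_subset; apply/subsetP=> _ /imsetP[x xM ->].
    by rewrite inE; exact: gnS'.
  - exact: gO.
  - by move=> x /fP; exact: ler_wpM2l.
  (* In this and the next case [O'] is [O] without [g x]. In the last two, where [x] lies in [O] and
     [g x = x], it is [O] without [x], respectively without both [x] and [y]; choosing [x] puts [x]
     back into the union. *)
  - move=> x /setDP[xM xO]; rewrite /W xMl // lerBrDr pad_origU1l.
    rewrite -[O :|: pad_orig S]/A AD ?gnS' ?xMp // setUCA -pad_origU1l.
    apply: HO; rewrite ?xMl ?subsetDl //= !inE ?eqxx ?andbF //.
    by rewrite (negPf xO) andbF.
  - move=> x /setDP[xM xN]; have xM' : inr x \in M.
      by move: xM xN; rewrite !inE => /orP[->|].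
    rewrite /W ifN; last by move: xN; rewrite inE.
    rewrite lerBrDr pad_origU1r -[O :|: pad_orig S]/A AD ?gnS' //.
    rewrite -{1 2}(pad_origU1r x S); apply: HO; rewrite ?subsetDl //= !inE ?eqxx //.
    by apply/negP=> /andP[/negP + xO]; apply; rewrite gO.
  - move=> x /setIP[xM xO]; rewrite /W xMl // lerBrDr.
    have -> : O :|: pad_orig S = O :\ x :|: pad_orig (inl x |: S).
      by rewrite pad_origU1l setUCA setUA setD1K.
    by apply: HO; rewrite ?xMl ?subsetDl //= ?gO ?xMp // !inE eqxx.
  - move=> x y /setIP[xM xO] /setIP[yM yO] xy; rewrite /W xMl // lerBrDr.
    have -> : (O :|: pad_orig S) :\ y = O :\ y :\ x :|: pad_orig (inl x |: S).
      rewrite AD ?xS ?xMp // pad_origU1l setUCA setUA setD1K //.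
      by rewrite !inE xy.
    apply: HO; rewrite ?xMl //= ?gO ?xMp // ?inE ?eqxx //.
    by apply: subset_trans (subsetDl _ _) (subsetDl _ _).
have HA : f A - f (pad_orig S) <= marg_weight f S M.
  apply: le_trans (rule_weight_max matI vr indS dO OI).
  by rewrite /A setUC; exact: submodular_addition_sum.
have SW := sum_pad_f f S M.
have EW : \sum_(x in pad_proj M) W x =
    \sum_(u in M) rrg_value f rule n (u |: S) - be * \sum_(u in M) f (pad_orig (u |: S)).
  rewrite mulr_sumr -sumrB -(big_sum_pad_proj _ indM); exact: eq_bigr.
have pMc : #|pad_proj M| = n.+1 by rewrite (card_pad_proj indM).
rewrite /= -/M cM ler_pdivlMl ?ltr0n //.
move: HW; rewrite EW SW pMc cM lerBrDr; apply: le_trans.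
have := ler_wpM2l be0 HA; rewrite -/A.
have n0 : n.+1%:R != 0 :> R by rewrite pnatr_eq0.
move: (f A) (f (pad_orig S)) (marg_weight f S M) (n.+1%:R : R) n0 => F G w m m0.
have -> : m * (((1 - 2 / m) * al + be / m) * F + ((1 - m^-1) * be + al / m) * G) =
   ((m - 2) * al + be) * F + ((m - 1) * be + al) * G by field.
lra.
Qed.

(** * Solving the recurrence *)

(** Write the power as [p * expR ((r - 1) * y)]; the tangent bound for [expR] is used once there and
    once as [p * (1 - y) <= 1]. *)
Lemma powR_bernoulli (R : realType) (p r : R) :
  0 < p -> 1 <= r -> 1 - r * (1 - p) <= p `^ r.
Proof.
move=> p0 r1; pose y := ln p.
have pE : p = expR y by rewrite /y lnK ?posrE.
have -> : p `^ r = p * expR ((r - 1) * y).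
  by rewrite /powR gt_eqF // pE expRK -expRD; congr expR; ring.
have H1 := expR_ge1Dx ((r - 1) * y); have H2 := expR_ge1Dx (- y).
have H3 : p * expR (- y) = 1 by rewrite pE -expRD subrr expR0.
have := ler_wpM2l (ltW p0) H1; have := ler_wpM2l (ltW p0) H2; rewrite H3 => K2 K1.
have r1' : 0 <= r - 1 by lra.
have := ler_wpM2l r1' K2; lra.
Qed.

(* In the eigenbasis of the recurrence [rrg_guarantee_step], whose eigenvalues are
   [1 - a / n] and [1 - b / n] with [a + b = 3] and [a * b = 1]. *)
Lemma rrg_guarantee_eigen_step (T : finType) (R : realFieldType) (I : {set {set T}})
    (f : {set T} -> R) (rule : {set T + T} -> {set T + T}) (n : nat) (a b p q : R) :
  is_matroid I -> (forall S, 0 <= f S) -> submodular f -> valid_rule I f rule ->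
  a + b = 3 -> a * b = 1 -> (0 < n)%N ->
  rrg_guarantee I f rule n ((p - q) / (b - a)) (((2 - a) * p + (b - 2) * q) / (b - a)) ->
  let p' := (1 - a / n.+1%:R) * p in let q' := (1 - b / n.+1%:R) * q in
  rrg_guarantee I f rule n.+1
    ((p' - q') / (b - a)) (((2 - a) * p' + (b - 2) * q') / (b - a)).
Proof.
move=> matI f0 subf vr abD abM n0 G p' q'; have [al0 be0 _] := G.
have := rrg_guarantee_step matI f0 subf vr _ G.
set al := (p - q) / (b - a) in al0 *; set be := (_ + _) / (b - a) in be0 *.
have -> : (1 - 2 / n.+1%:R) * al + be / n.+1%:R = (p' - q') / (b - a).
  by rewrite /al /be /p' /q'; ring.
have -> : (1 - n.+1%:R^-1) * be + al / n.+1%:R =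
    ((2 - a) * p' + (b - 2) * q') / (b - a).
  have bE : b = 3 - a by lra.
  have a2 : a * a = 3 * a - 1 by move: abM; rewrite bE; lra.
  rewrite /al /be /p' /q' bE.
  have -> : (2 - a) * ((1 - a / n.+1%:R) * p) =
    ((2 - a) - (2 * a - a * a) / n.+1%:R) * p by ring.
  have -> : (3 - a - 2) * ((1 - (3 - a) / n.+1%:R) * q) =
    ((3 - a - 2) - (3 - 4 * a + a * a) / n.+1%:R) * q by ring.
  rewrite a2; ring.
apply; have -> : (p' - q') / (b - a) = (1 - 2 / n.+1%:R) * al + be / n.+1%:R.
  by rewrite /al /be /p' /q'; ring.
(* Since [0 < n], the factor [1 - 2 / n.+1%:R] is nonnegative. *)
apply: addr_ge0; last by apply: divr_ge0.
apply: mulr_ge0 => //; rewrite subr_ge0.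
by rewrite ler_pdivrMr ?ltr0n // mul1r ler_nat.
Qed.

(** The pair [s], [1 - s] has eigencoordinates [1 - a * s] and [1 - b * s], and every step
    multiplies them by the two eigenvalues. *)
Lemma rrg_guarantee_run (T : finType) (R : realFieldType) (I : {set {set T}})
    (f : {set T} -> R) (rule : {set T + T} -> {set T + T}) (j k : nat) (a b s : R) :
  is_matroid I -> (forall S, 0 <= f S) -> submodular f -> valid_rule I f rule ->
  a + b = 3 -> a * b = 1 -> a < b -> (0 < j <= k)%N ->
  rrg_guarantee I f rule j s (1 - s) ->
  let p := \prod_(j <= i < k) (1 - a / i.+1%:R) * (1 - a * s) in
  let q := \prod_(j <= i < k) (1 - b / i.+1%:R) * (1 - b * s) in
  rrg_guarantee I f rule k
    ((p - q) / (b - a)) (((2 - a) * p + (b - 2) * q) / (b - a)).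
Proof.
move=> matI f0 subf vr abD abM ab /andP[j0 jk] G.
have ba0 : b - a != 0 by rewrite subr_eq0 gt_eqF.
elim: k jk => [|k IHk]; first by case: j j0 {G}.
rewrite leq_eqVlt => /orP[/eqP <-|].
  rewrite !big_geq //= !mul1r.
  have -> : (1 - a * s - (1 - b * s)) / (b - a) = s by field.
  have -> : ((2 - a) * (1 - a * s) + (b - 2) * (1 - b * s)) / (b - a) =
     1 - (a + b - 2) * s by field.
  by rewrite abD; have -> : (3 - 2) * s = s by ring.
rewrite ltnS => jk /=; rewrite !big_nat_recr //=.
rewrite ![_ * (1 - _ / k.+1%:R)]mulrC -!mulrA.
by apply: rrg_guarantee_eigen_step (IHk jk) => //; exact: leq_trans jk.
Qed.

(** Here [P] is [expR (- (a * x))]. The bound [1 / 3] settles ranks up to 3; the last inequality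
    later shows that stopping happens with at least two steps remaining. *)
Lemma rrg_const_spec (R : realType) : exists a b P : R,
  [/\ a + b = 3 /\ a * b = 1, 3 / 8 <= a <= 5 / 13, 0 < P < 1,
      rrg_const R = (P - P `^ (b / a)) / (b - a) /\ rrg_const R <= 1 / 3 &
      (1 - a / 2) * (1 - a / 3) * (1 - a / 4) < P].
Proof.
pose s := Num.sqrt (5 : R); pose a := (3 - s) / 2; pose b := (3 + s) / 2.
pose L := ln (b / a); pose x := L / s; pose P := expR (- (a * x)).
have cE : rrg_const R = (P - expR (- (b * x))) / s by [].
have s2 : s * s = 5 by rewrite -expr2 sqr_sqrtr.
have s0 : 0 <= s by exact: sqrtr_ge0.
have sl : 29 / 13 <= s by clear -s2 s0; clearbody s; nra.
have su : s <= 9 / 4 by clear -s2 s0; clearbody s; nra.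
have al : 3 / 8 <= a by rewrite /a; lra.
have au : a <= 5 / 13 by rewrite /a; lra.
have abD : a + b = 3 by rewrite /a /b; field.
have abM : a * b = 1.
  have -> : a * b = (9 - s * s) / 4 by rewrite /a /b; field.
  by rewrite s2; field.
have sE : b - a = s by rewrite /a /b; field.
have a0 : 0 < a by lra.
have b0 : 0 < b by lra.
have LE : expR L = b / a by rewrite lnK // posrE divr_gt0.
have xE : x * s = L by rewrite /x divfK //; lra.
clearbody x L; clearbody a b; clearbody s.
have aV : a^-1 = b by apply: (mulfI (lt0r_neq0 a0)); rewrite abM divff // lt0r_neq0.
have bV : b^-1 = a by rewrite -aV invrK.
have a2 : a * a = 3 * a - 1.
  by have := mulrDr a a b; rewrite abD abM mulrC; lra.
have as_ : a * s = 1 - a * a by rewrite -sE mulrBr abM.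
have LVE : expR (- L) = a * a by rewrite expRN LE invf_div bV.
have L_ge : 1 - a * a <= L by have := expR_ge1Dx (- L); rewrite LVE; lra.
(* Here [expR (9 / 4)] is the eighth power of [E], and [E] is at least [1 + 9 / 32]. Four factors
   already exceed [b], and [b / a = b * b]. *)
have L_le : L <= 9 / 4.
  rewrite -ler_expR LE aV; pose E := expR (9 / 32 : R).
  have E1 : 41 / 32 <= E by apply: le_trans (expR_ge1Dx _); lra.
  have E2 : 13 / 8 <= E * E by nra.
  have E4 : b <= E * E * (E * E) by nra.
  have -> : expR (9 / 4) = E * E * (E * E) * (E * E * (E * E)).
    by rewrite -!expRD; congr expR; field.
  by apply: ler_pM => //; lra.
have ax_ge : a * a <= a * x.
  by apply: ler_wpM2l; [lra | rewrite -(ler_pM2r (x := s)); lra].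
have ax_le : a * x <= 7 / 18.
  rewrite -(ler_pM2r (x := s)); last lra.
  rewrite -mulrA xE; apply: (@le_trans _ _ (5 / 13 * (9 / 4))); last lra.
  by apply: ler_pM => //; lra.
have P0 : 0 < P by exact: expR_gt0.
have P_lt1 : P < 1 by rewrite -[X in _ < X]expR0 ltr_expR; nra.
(* Halving the exponent before the tangent bound gives [29 / 36] squared, which is enough; the
   undivided bound [11 / 18] would not be. *)
have P_ge : 24 / 37 < P.
  have -> : P = expR (- (a * x) / 2) * expR (- (a * x) / 2).
    by rewrite -expRD; congr expR; field.
  by have := expR_ge1Dx (- (a * x) / 2); nra.
have P_le : P * (1 + a * a) <= 1.
  have PE : P * expR (a * x) = 1 by rewrite -expRD addNr expR0.
  by rewrite -[leRHS]PE ler_pM2l //; have := expR_ge1Dx (a * x); lra.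
have bxE : expR (- (b * x)) = P * (a * a).
  by rewrite -LVE -expRD; congr expR; rewrite -xE -sE; ring.
have PrE : P `^ (b / a) = expR (- (b * x)).
  rewrite /powR gt_eqF // expRK; congr expR.
  by rewrite mulrN mulrA divfK // lt0r_neq0.
exists a, b, P; split; rewrite ?al ?P0 //.
  (* As [(b - a) * x = L], the constant equals [P * a]; and [a * a = 3 * a - 1] turns [P_le] into
     [P * (3 * a) <= 1]. *)
  rewrite PrE sE cE; split=> //; rewrite bxE ler_pdivrMr; last lra.
  have -> : P - P * (a * a) = P * a * s by rewrite -mulrA as_; ring.
  rewrite ler_pM2r; last lra.
  have : P * (3 * a) <= 1 by apply: le_trans P_le; rewrite a2; lra.
  lra.
apply: lt_trans P_ge => //.
apply: (@le_lt_trans _ _ (5 / 7 * (29 / 32))); last lra.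
apply: ler_pM; [|lra| |lra]; first by apply: mulr_ge0; lra.
apply: (@le_trans _ _ (13 / 16 * (7 / 8))); last lra.
by apply: ler_pM; lra.
Qed.

(** Bernoulli's inequality is applied factor by factor. With [1 < j] every denominator is at least
    3, hence at least [b], so no factor of the [b] product is negative. *)
Lemma prod_step_powR (R : realType) (a b : R) (j k : nat) :
  0 < a < 1 -> a <= b <= 3 -> (1 < j)%N ->
  0 <= \prod_(j <= i < k) (1 - b / i.+1%:R) <=
    (\prod_(j <= i < k) (1 - a / i.+1%:R)) `^ (b / a) /\
  0 < \prod_(j <= i < k) (1 - a / i.+1%:R) <= 1.
Proof.
move=> /andP[a0 a1] /andP[ab b3] j1.
elim: k => [|k [/andP[q0 qp] /andP[p0 p1]]].
  by rewrite !big_geq // powR1 ler01 lexx ltr01.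
have [jk|kj] := leqP j k; last by rewrite !big_geq // powR1 ler01 lexx ltr01.
rewrite !big_nat_recr //=.
set p := \prod_(_ <= _ < _) _ in qp p0 p1 *; set q := \prod_(_ <= _ < _) _ in q0 qp *.
have k3 : 3 <= k.+1%:R :> R by rewrite ler_nat; exact: leq_trans j1 jk.
have [y yE] : exists y : R, y = k.+1%:R^-1 by exists k.+1%:R^-1.
have y0 : 0 < y by rewrite yE invr_gt0; lra.
have yk : y * k.+1%:R = 1 by rewrite yE mulVf //; lra.
have y3 : y * 3 <= 1 by have := ler_wpM2l (ltW y0) k3; rewrite yk.
rewrite -!yE.
have ay0 : 0 < a * y by rewrite mulr_gt0.
have by1 : 0 <= 1 - b * y by nra.
have pa : 0 < 1 - a * y by nra.
have ber : 1 - b * y <= (1 - a * y) `^ (b / a).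
  apply: le_trans (powR_bernoulli pa _); last by rewrite ler_pdivlMr // mul1r.
  have -> : b / a * (1 - (1 - a * y)) = b * y by field; lra.
  exact: lexx.
rewrite powRM; [|lra|lra].
split; apply/andP; split.
- exact: mulr_ge0.
- exact: ler_pM.
- exact: mulr_gt0.
- nra.
Qed.

Lemma rrg_guarantee_const (T : finType) (R : realType) (I : {set {set T}})
    (f : {set T} -> R) (rule : {set T + T} -> {set T + T}) (k : nat) :
  is_matroid I -> (forall S, 0 <= f S) -> submodular f -> valid_rule I f rule ->
  (0 < k)%N ->
  exists al be, rrg_guarantee I f rule k al be /\ rrg_const R <= al.
Proof.
move=> matI f0 subf vr k0.
have [a [b [P [[abD abM] /andP[al au] /andP[P0 P1] [cE c3] Plow]]]] := rrg_const_spec R.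
have one_step n : rrg_guarantee I f rule n.+1 n.+1%:R^-1 (1 - n.+1%:R^-1).
  have := rrg_guarantee_step matI f0 subf vr _ (rrg_guarantee_current n matI vr).
  rewrite mulr0 add0r mulr1 mul1r mul0r addr0; apply.
  by rewrite invr_ge0.
(* For rank at most 3, a single step followed by stopping already yields [1 / k]. Larger ranks leave
   room for the three factors split off below. *)
have [k3|k4] := leqP k 3.
  exists k%:R^-1, (1 - k%:R^-1); split; first by case: k k0 {k3}.
  apply: (le_trans c3); rewrite div1r lef_pV2 ?posrE ?ltr0n //.
  by rewrite ler_nat.
pose Pr j := \prod_(j <= i < k) (1 - a / i.+1%:R).
have a01 : 0 < a < 1 by apply/andP; split; lra.
have ab3 : a <= b <= 3 by apply/andP; split; lra.
have exj : exists j, (0 < j)%N && (P <= Pr j).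
  by exists k; rewrite k0 /Pr big_geq // ltW.
case: (ex_minnP exj) => j /andP[j0 Pj] jmin.
have jk : (j <= k)%N by apply: jmin; rewrite k0 /Pr big_geq // ltW.
(* With [j = 1] the product [Pr j] would contain the three factors of [Plow], the rest being at most
   1, and would fall below [P]. *)
have j1 : (1 < j)%N.
  rewrite ltn_neqAle j0 andbT; apply/eqP=> j1; move: Pj; rewrite -j1 /Pr.
  rewrite (big_cat_nat (n := 4)) //= big_ltn // big_ltn // big_ltn // big_geq // mulr1.
  have [_ /andP[q0 q1]] := prod_step_powR k a01 ab3 (isT : (1 < 4)%N).
  rewrite leNgt => /negP; apply; apply: le_lt_trans Plow.
  rewrite mulrA ler_piMr // !mulr_ge0 //; lra.
have [/andP[Q0 QP] /andP[Pr0 Pr1]] := prod_step_powR k a01 ab3 j1.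
rewrite -/(Pr j) in QP Pr0 Pr1.
case: j j0 Pj jmin jk j1 Q0 QP Pr0 Pr1 => // j _ Pj jmin jk j1 Q0 QP Pr0 Pr1.
have Pj' : (1 - a / j.+1%:R) * Pr j.+1 < P.
  rewrite ltNge; apply/negP=> H; have := jmin j.
  by rewrite -ltnS j1 /= {1}/Pr big_ltn // H ltnn => /(_ isT).
(* The mixture of stopping at [j] and at [j.+1] that makes [Pr] hit [P] exactly. *)
pose s := (1 - P / Pr j.+1) / a.
have a0 : 0 < a by lra.
have asE : 1 - a * s = P / Pr j.+1 by rewrite /s; field; lra.
have s0 : 0 <= s.
  by apply: divr_ge0; [rewrite subr_ge0 ler_pdivrMr // mul1r | exact: ltW].
(* The mixture weight is [j.+1%:R * s]; minimality of the stopping index, in the form [Pj'], keeps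
   it at most 1. *)
have s1 : j.+1%:R * s <= 1.
  have : 1 - a / j.+1%:R < 1 - a * s by rewrite asE ltr_pdivlMr.
  rewrite ltrD2l ltrN2 ltr_pM2l // => /ltW.
  by rewrite -[_^-1]mul1r ler_pdivlMr ?ltr0n // mulrC.
have Gs : rrg_guarantee I f rule j.+1 s (1 - s).
  have t01 : 0 <= j.+1%:R * s <= 1 by rewrite s1 mulr_ge0.
  have := rrg_guarantee_convex t01 (one_step j) (rrg_guarantee_current j.+1 matI vr).
  have jn : j.+1%:R != 0 :> R by rewrite pnatr_eq0.
  have -> : j.+1%:R * s * j.+1%:R^-1 + (1 - j.+1%:R * s) * 0 = s.
    by rewrite mulr0 addr0 mulrAC divff // mul1r.
  have -> // : j.+1%:R * s * (1 - j.+1%:R^-1) + (1 - j.+1%:R * s) * 1 = 1 - s.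
  by rewrite mulrBr !mulr1 mulrAC divff // mul1r; ring.
have ab : a < b by lra.
have /= := rrg_guarantee_run matI f0 subf vr abD abM ab _ Gs; move=> /(_ k jk) G.
eexists; eexists; split; first exact: G.
have PrsE : Pr j.+1 * (1 - a * s) = P by rewrite asE mulrC divfK // gt_eqF.
rewrite cE ler_pM2r ?invr_gt0 ?subr_gt0 // -/(Pr j.+1) PrsE lerD2l lerN2.
have pa : 0 < 1 - a * s by rewrite asE divr_gt0.
have ber : 1 - b * s <= (1 - a * s) `^ (b / a).
  apply: le_trans (powR_bernoulli pa _); last by rewrite ler_pdivlMr // mul1r ltW.
  have -> : b / a * (1 - (1 - a * s)) = b * s by field; lra.
  exact: lexx.
apply: (le_trans (ler_wpM2l Q0 ber)).
have -> : P `^ (b / a) = Pr j.+1 `^ (b / a) * (1 - a * s) `^ (b / a).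
  by rewrite -powRM ?(ltW pa) ?(ltW Pr0) // PrsE.
by rewrite ler_wpM2r // powR_ge0.
Qed.

Theorem theorem4 (R : realType) (T : finType) (I : {set {set T}})
  (f : {set T} -> R) (rule : {set T + T} -> {set T + T}) :
  is_matroid I ->
  (forall S, 0 <= f S) ->
  submodular f ->
  valid_rule I f rule ->
  forall OPT : {set T}, OPT \in I ->
    rrg_const R * f OPT <= rrg_value f rule (mrank I) set0.
Proof.
move=> matI f0 subf vr OPT OI; have [I0 _ _] := matI.
have o0 : pad_orig (set0 : {set T + T}) = set0 by apply/setP=> x; rewrite !inE.
have p0 : pad_proj (set0 : {set T + T}) = set0 by apply/setP=> x; rewrite !inE.
have ind0 : pad_indep I set0.
  by rewrite /pad_indep p0 I0 andbT; apply/forallP=> x; rewrite !inE.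
(* In rank zero no step is made and only the empty set is feasible; there it suffices that the
   constant is at most 1. *)
have [k0|k0] := posnP (mrank I).
  have -> : OPT = set0.
    by apply/eqP; rewrite -cards_eq0 -leqn0 -k0 mrank_ge.
  have [a [b [P [_ _ _ [_ c3] _]]]] := rrg_const_spec R.
  by rewrite k0 /= o0 ler_piMl //; lra.
have [al [be [[al0 be0 G] c_al]]] := rrg_guarantee_const matI f0 subf vr k0.
have := G set0 OPT ind0; rewrite cards0 add0n p0 o0 !setU0 => /(_ erefl).
rewrite -setI_eq0 setI0 => /(_ (eqxx _) OI); apply: le_trans.
by rewrite -[leLHS]addr0 lerD ?ler_wpM2r // mulr_ge0.
Qed.
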